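(* Let $f:\mathbb{R}^d\to\mathbb{R}$ be convex, differentiable, and $L$-smooth (with respect to $\|\cdot\|_2$), for $L>0$. Let $\theta_0\in\mathbb{R}^d$ and consider the gradient descent iterates $\theta_{t+1}=\theta_t-\eta\nabla f(\theta_t)$, $t=0,1,2,\dots$, with constant step size $\eta\in(0,1/L]$. Then for any $T\ge1$ and $\lambda_T=1/(\eta T)$, $$\min_{z\in\mathbb{R}^d}\Big(f(z)+\frac{\lambda_T}{4}\|\theta_0-z\|_2^2\Big)\le f(\theta_T)+\frac{\lambda_T}{4}\|\theta_0-\theta_T\|_2^2\le\min_{z\in\mathbb{R}^d}\Big(f(z)+\lambda_T\|\theta_0-z\|_2^2\Big).$$
   Context: A differentiable function $f$ is $L$-smooth with respect to $\|\cdot\|_2$ if $\|\nabla f(x)-\nabla f(y)\|_2\le L\|x-y\|_2$ for all $x,y$. *)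

(* Defs.v *)
From mathcomp Require Import all_boot all_order all_algebra.
From mathcomp Require Import all_classical all_reals all_analysis.

Set Implicit Arguments.
Unset Strict Implicit.
Unset Printing Implicit Defensive.

Import Order.TTheory GRing.Theory Num.Theory.
Import numFieldNormedType.Exports.
Local Open Scope classical_set_scope.
Local Open Scope ring_scope.

(* The library norm `|x| on 'rV[R]_d is the sup norm. It induces the usual
   topology, hence the usual notion of differentiability; only the metric
   statements need the Euclidean norm. *)
Definition norm2 (R : realType) (d : nat) (x : 'rV[R]_d) : R :=
  Num.sqrt (\sum_(i < d) x ord0 i ^+ 2).

Definition grad (R : realType) (d : nat) (f : 'rV[R]_d -> R) (x : 'rV[R]_d) :
  'rV[R]_d := \row_(i < d) 'D_(delta_mx ord0 i) f x.

(* Only meaningful for differentiable f: the directional derivatives used in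
   grad are total functions with junk values otherwise. *)
Definition L_smooth (R : realType) (d : nat) (L : R) (f : 'rV[R]_d -> R) :
    Prop :=
  forall x y : 'rV[R]_d, norm2 (grad f x - grad f y) <= L * norm2 (x - y).

(* An attained minimum, as opposed to an infimum. *)
Definition is_min (R : realType) (T : Type) (g : T -> R) (m : R) : Prop :=
  range g m /\ lbound (range g) m.

(* Main.v *)
Require Import Defs.
From mathcomp Require Import all_boot all_order all_algebra.
From mathcomp Require Import all_classical all_reals all_analysis.
From mathcomp Require Import ring lra.
Import Order.TTheory GRing.Theory Num.Theory.
Import numFieldNormedType.Exports.
Local Open Scope classical_set_scope.
Local Open Scope ring_scope.

(** Write [<u, v>] for the Euclidean inner product and [|u|] for its norm.

    The left inequality compares a minimum with the value at one point, namely
    [theta T]; its content is that the minimum is attained ([prox_is_min]).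

    The right inequality combines two facts. The first is the usual rate of
    gradient descent with step at most [1 / L] ([gd_rate]): for every point [z],
    [2 eta T (f (theta T) - f z) <= |theta 0 - z|^2 - |theta T - z|^2].
    It comes from one step ([gd_step]), where smoothness, in the form of the
    descent lemma ([smooth_descent]), and convexity, in the form of the tangent
    inequality ([convex_grad_le]), fit together so that the decrease of the
    squared distance to [z] pays for the excess of [f] over [f z]; summing the
    steps telescopes.

    The second fact is
    [|theta 0 - theta T|^2 <= 2 |theta 0 - z|^2 + 2 |theta T - z|^2]
    ([sqr_dist_le_double]). Multiplied by [lambda / 4 = 1 / (4 eta T)], its term
    in [|theta T - z|^2] has coefficient [1 / (2 eta T)], which is precisely the
    negative term left over by the rate, and the terms in [|theta 0 - z|^2] add
    up to [lambda |theta 0 - z|^2]. Taking for [z] a minimizer of the right-hand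
    objective concludes. *)

(** * Euclidean geometry of row vectors *)

Definition dot {R : realType} {d : nat} (u v : 'rV[R]_d) : R :=
  \sum_(i < d) u ord0 i * v ord0 i.

Section Euclidean.
Context {R : realType} {d : nat}.
Implicit Types (u v w : 'rV[R]_d) (k : R).

Lemma dotC u v : dot u v = dot v u.
Proof. by apply: eq_bigr => i _; rewrite mulrC. Qed.

Lemma dotDl u v w : dot (u + v) w = dot u w + dot v w.
Proof. by rewrite -big_split; apply: eq_bigr => i _; rewrite mxE mulrDl. Qed.

Lemma dotZl k u w : dot (k *: u) w = k * dot u w.
Proof. by rewrite mulr_sumr; apply: eq_bigr => i _; rewrite mxE mulrA. Qed.

Lemma dot0l w : dot 0 w = 0.
Proof. by rewrite -(scale0r 0) dotZl mul0r. Qed.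

Lemma dotBl u v w : dot (u - v) w = dot u w - dot v w.
Proof. by rewrite dotDl -scaleN1r dotZl mulN1r. Qed.

Lemma dotBr u v w : dot w (u - v) = dot w u - dot w v.
Proof. by rewrite dotC dotBl !(dotC _ w). Qed.

Lemma dotZr k u w : dot w (k *: u) = k * dot w u.
Proof. by rewrite dotC dotZl dotC. Qed.

Lemma dot_ge0 u : 0 <= dot u u.
Proof. by apply: sumr_ge0 => i _; rewrite -expr2 sqr_ge0. Qed.

Lemma sqr_norm2 u : norm2 u ^+ 2 = dot u u.
Proof.
rewrite sqr_sqrtr; first by apply: eq_bigr => i _; rewrite expr2.
by apply: sumr_ge0 => i _; exact: sqr_ge0.
Qed.

Lemma normr_coord_le_norm2 u i : `|u ord0 i| <= norm2 u.
Proof.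
rewrite -sqrtr_sqr ler_wsqrtr// (bigD1 i)//= lerDl sumr_ge0// => j _.
exact: sqr_ge0.
Qed.

Lemma norm2Z k u : 0 <= k -> norm2 (k *: u) = k * norm2 u.
Proof.
move=> k0; rewrite -{2}(ger0_norm k0) -sqrtr_sqr -sqrtrM ?sqr_ge0//.
rewrite mulr_sumr; congr Num.sqrt.
by apply: eq_bigr => i _; rewrite mxE exprMn.
Qed.

(** This is how the Lipschitz bound on the gradient enters the descent lemma.
    Cauchy-Schwarz would give it, but so does [0 <= |u - k v|^2]: expanding,
    [2 k <u, v> <= |u|^2 + k^2 |v|^2 <= 2 k^2 |v|^2], and [k > 0] cancels. *)
Lemma dot_le_of_norm2_le u v k :
  0 < k -> norm2 u <= k * norm2 v -> dot u v <= k * dot v v.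
Proof.
move=> k0 uv.
have u2 : dot u u <= k ^+ 2 * dot v v.
  by rewrite -!sqr_norm2 -exprMn lerXn2r// ?nnegrE ?mulr_ge0 ?sqrtr_ge0 ?ltW.
have := dot_ge0 (u - k *: v).
rewrite dotBl !dotBr !dotZl !dotZr (dotC v u) => uv2.
rewrite -(ler_pM2l k0); lra.
Qed.

(** The parallelogram law, with the square of the other diagonal dropped. *)
Lemma sqr_dist_le_double u v w :
  dot (u - v) (u - v) <=
  2 * dot (u - w) (u - w) + 2 * dot (v - w) (v - w).
Proof.
have -> : u - v = (u - w) - (v - w) by rewrite opprB addrA subrK.
have := dot_ge0 ((u - w) + (v - w)).
move: (u - w) (v - w) => p q.
rewrite dotDl dotBl !dotBr !(dotC _ (p + q)) !dotDl (dotC q p).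
lra.
Qed.

Lemma continuous_sqr_dist u : continuous (fun v => norm2 (u - v) ^+ 2).
Proof.
have cvg_coord (v : 'rV[R]_d) i : (u - w) ord0 i @[w --> v] --> (u - v) ord0 i.
  under eq_fun do rewrite !mxE.
  rewrite !mxE.
  exact: (cvgB (cvg_cst (u ord0 i)) (@coord_continuous R _ _ ord0 i v)).
under eq_fun do rewrite sqr_norm2.
apply: (@continuous_big R _ +%R 0 xpredT add_continuous 'rV[R]_d _
  (fun i v => (u - v) ord0 i * (u - v) ord0 i)) => i _ v.
exact: cvgM (cvg_coord v i) (cvg_coord v i).
Qed.

End Euclidean.

(** * First-order inequalities for smooth convex functions *)

Section Gradient.
Context {R : realType} {d : nat} (f : 'rV[R]_d -> R)
  (f_diff : forall x : 'rV[R]_d, differentiable f x).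

(** Differentiability makes ['D_v f x] linear in [v]; the partial derivatives
    stored in [grad f x] therefore determine it in every direction. *)
Lemma derive_grad (x v : 'rV[R]_d) : 'D_v f x = dot (grad f x) v.
Proof.
rewrite deriveE// {1}(row_sum_delta v) linear_sum; apply: eq_bigr => i _.
by rewrite linearZ /= mxE deriveE// mulrC.
Qed.

Lemma is_derive_line (x v : 'rV[R]_d) (s : R) :
  is_derive s (1 : R) (fun t : R => f (x + t *: v))
    (dot (grad f (x + s *: v)) v).
Proof.
have E : (fun h : R => h^-1 *:
      (((fun t : R => f (x + t *: v)) \o shift s) (h *: 1) - f (x + s *: v))) =
    (fun h : R => h^-1 *: ((f \o shift (x + s *: v)) (h *: v) - f (x + s *: v))).
  apply/funext => h /=; congr (_ *: (f _ - _)).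
  by rewrite [h *: 1]mulr1 scalerDl addrCA.
apply: DeriveDef.
  by rewrite /derivable E; exact: diff_derivable.
by rewrite /derive E -derive_grad.
Qed.

Lemma convex_segment_le (x y : 'rV[R]_d) (h : R) :
  convex_function [set: convex_lmodType 'rV[R]_d] f -> 0 <= h -> h <= 1 ->
  f (x + h *: (y - x)) <= f x + h * (f y - f x).
Proof.
move=> f_convex h0 h1.
have -> : x + h *: (y - x) = h *: y + (1 - h) *: x.
  by rewrite scalerBr scalerBl scale1r addrCA.
have -> : f x + h * (f y - f x) = h * f y + (1 - h) * f x by ring.
exact: f_convex (Itv01 h0 h1) y x (mem_setT _) (mem_setT _).
Qed.

(** The graph lies above its tangents: the slopes
    [(f (x + h (y - x)) - f x) / h], for [0 < h <= 1], are at most [f y - f x],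
    and the directional derivative is their limit as [h] decreases to [0]. *)
Lemma convex_grad_le (x y : 'rV[R]_d) :
  convex_function [set: convex_lmodType 'rV[R]_d] f ->
  f x + dot (grad f x) (y - x) <= f y.
Proof.
move=> f_convex; rewrite addrC -lerBrDr -derive_grad.
have dv : derivable f x (y - x) by exact: diff_derivable.
rewrite /derive cvg_at_rightE//; apply: limr_le.
  rewrite -(cvg_at_rightE (fun h => h^-1 *: ((f \o shift x) _ - f x)))//.
  apply: cvg_trans dv; apply: cvg_app.
  move=> A [e e0 Ae]; exists e => // h he h0.
  by apply: Ae => //; exact/lt0r_neq0.
near=> h.
have h0 : 0 < h by near: h; exact: nbhs_right_gt.
have h1 : h <= 1 by near: h; apply: nbhs_right_le; exact: ltr01.
rewrite [_ *: _]mulrC ler_pdivrMr//= (addrC _ x) lerBlDl mulrC.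
exact: convex_segment_le f_convex (ltW h0) h1.
Unshelve. all: by end_near. Qed.

(** The descent lemma. Along the segment from [x] to [x + v], the function
    [phi] of the proof is [f] minus the claimed quadratic upper bound, up to a
    constant; its derivative is nonpositive for positive parameters because the
    gradient is [L]-Lipschitz, so the mean value theorem gives
    [phi 1 <= phi 0]. *)
Lemma smooth_descent (L : R) (x v : 'rV[R]_d) : 0 < L -> L_smooth L f ->
  f (x + v) <= f x + dot (grad f x) v + L / 2 * dot v v.
Proof.
move=> L0 f_smooth.
pose phi (s : R) :=
  f (x + s *: v) - (s * dot (grad f x) v + s ^+ 2 * (L / 2 * dot v v)).
pose dphi (s : R) :=
  dot (grad f (x + s *: v)) v - (dot (grad f x) v + s * (L * dot v v)).
have dphiP (s : R) : is_derive s (1 : R) phi (dphi s).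
  pose proof (is_derive_line x v s) as line.
  apply: is_derive_eq.
  (* The derivation rules scale [R] as a module over itself; this turns the
     scaling into a product. *)
  have scaleE (k l : R) : k *: (l : R^o) = k * l by [].
  by rewrite /dphi !scaleE; field.
have phi_cont : {within `[0, 1], continuous phi}.
  apply: continuous_subspaceT => s.
  by apply/differentiable_continuous/derivable1_diffP; have [] := dphiP s.
have [c c01] := MVT ltr01 (fun s _ => dphiP s) phi_cont.
have c0 : 0 < c by move: c01; rewrite in_itv => /andP[].
rewrite /phi /dphi !scale1r scale0r addr0 expr1n expr0n /= !mul0r !mul1r => E.
suff : dot (grad f (x + c *: v)) v - dot (grad f x) v <= c * L * dot v v by lra.
rewrite -dotBl; apply: dot_le_of_norm2_le; first exact: mulr_gt0.
apply: le_trans (f_smooth _ _) _; rewrite (addrC x) addrK.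
by rewrite norm2Z ?(ltW c0)// mulrCA mulrA.
Qed.

(** * Convergence of gradient descent *)

(** One step, with [y = x - eta g] and [g] the gradient at [x]. Since
    [eta L <= 1], the descent lemma gives [f y <= f x - (eta / 2) |g|^2], and
    the tangent inequality bounds [f x] by [f z + <g, x - z>]. The resulting
    bound on [2 eta (f y - f z)], namely [2 eta <g, x - z> - eta^2 |g|^2], is
    exactly [|x - z|^2 - |y - z|^2]. *)
Lemma gd_step (L eta : R) (x z : 'rV[R]_d) :
  convex_function [set: convex_lmodType 'rV[R]_d] f ->
  0 < L -> L_smooth L f -> 0 < eta -> eta * L <= 1 ->
  2 * eta * (f (x - eta *: grad f x) - f z) <=
  dot (x - z) (x - z) -
  dot (x - eta *: grad f x - z) (x - eta *: grad f x - z).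
Proof.
move=> f_convex L0 f_smooth eta0 etaL.
set g := grad f x; set y := x - eta *: g.
have gz := convex_grad_le x z f_convex.
have := smooth_descent L x (- eta *: g) L0 f_smooth.
rewrite {1}scaleNr -/g -/y dotZr dotZl dotZr => gy.
have -> : y - z = (x - z) - eta *: g by rewrite addrAC.
move: gz; rewrite -(opprB x z) -scaleN1r dotZr -/g.
move: (x - z) => e gz.
rewrite dotBl !dotBr !dotZl !dotZr (dotC e g).
have g0 := dot_ge0 g.
have : eta * (eta * L) * dot g g <= eta * 1 * dot g g.
  by rewrite ler_wpM2r// ler_wpM2l// ltW.
rewrite mulr1 => gL.
have : f y - f z <= dot g e - eta * dot g g / 2 by lra.
rewrite -(ler_pM2l eta0); lra.
Qed.

(** The distances to [z] telescope when the one-step bounds are added, and the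
    value at the last iterate is the smallest of those summed. *)
Lemma gd_rate (L eta : R) (theta : nat -> 'rV[R]_d) (z : 'rV[R]_d) (T : nat) :
  convex_function [set: convex_lmodType 'rV[R]_d] f ->
  0 < L -> L_smooth L f -> 0 < eta -> eta * L <= 1 ->
  (forall t, theta t.+1 = theta t - eta *: grad f (theta t)) ->
  2 * (eta * T%:R) * (f (theta T) - f z) <=
  dot (theta 0 - z) (theta 0 - z) - dot (theta T - z) (theta T - z).
Proof.
move=> f_convex L0 f_smooth eta0 etaL gd.
elim: T => [|T IH]; first by rewrite mulr0 mulr0 mul0r subrr.
(* The reference point of the one-step bound is free: taking it to be the
   current iterate shows that the step does not increase [f]. *)
have decr : f (theta T.+1) <= f (theta T).
  have := gd_step L eta (theta T) (theta T) f_convex L0 f_smooth eta0 etaL.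
  rewrite -gd subrr dot0l sub0r => decr.
  have : 2 * eta * (f (theta T.+1) - f (theta T)) <= 0.
    by apply: le_trans decr _; rewrite oppr_le0 dot_ge0.
  by rewrite pmulr_rle0 ?subr_le0// mulr_gt0.
have := gd_step L eta (theta T) z f_convex L0 f_smooth eta0 etaL.
rewrite -gd -natr1 => step.
have : 2 * (eta * T%:R) * (f (theta T.+1) - f z) <=
       2 * (eta * T%:R) * (f (theta T) - f z).
  by rewrite ler_wpM2l ?lerB// !mulr_ge0// ltW.
lra.
Qed.

(** * Existence of the penalized minima *)

(** The tangent of [f] at [a] bounds the objective below by a quadratic. With
    [grad f a = 2 c q], completing the square turns this bound into
    [g a + c (|z - a + q|^2 - |q|^2)], so no [z] with [|z - a + q| > |q|] does
    better than [a]. All remaining points lie in a coordinate box around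
    [a - q], which is compact, and a minimizer over the box is global. *)
Lemma prox_is_min (a : 'rV[R]_d) (c : R) :
  convex_function [set: convex_lmodType 'rV[R]_d] f -> 0 < c ->
  exists m, is_min (fun z => f z + c * norm2 (a - z) ^+ 2) m.
Proof.
move=> f_convex c0.
have [q qE] : exists q, grad f a = (2 * c) *: q.
  exists ((2 * c)^-1 *: grad f a).
  by rewrite scalerA divff ?scale1r// mulf_neq0 ?gt_eqF.
pose g z := f z + c * norm2 (a - z) ^+ 2.
have g_lower z :
    g a + c * (dot (z - a + q) (z - a + q) - dot q q) <= g z.
  have := convex_grad_le a z f_convex; rewrite qE.
  rewrite /g !sqr_norm2 subrr dot0l -(opprB z a) -(scaleN1r (z - a)) !dotZl dotZr.
  move: (z - a) => e.
  rewrite dotDl !(dotC _ (e + q)) !dotDl (dotC e q); lra.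
pose A := [set v : 'rV[R]_d | forall i,
  v ord0 i \in `[a ord0 i - q ord0 i - norm2 q, a ord0 i - q ord0 i + norm2 q]].
have A_compact : compact A.
  apply: (@rV_compact _ _ (fun i : 'I_d =>
    `[a ord0 i - q ord0 i - norm2 q, a ord0 i - q ord0 i + norm2 q]%classic)).
  by move=> i; exact: segment_compact.
have Aa : A a.
  move=> i; have := normr_coord_le_norm2 q i.
  rewrite ler_norml in_itv /=; lra.
have g_cont : continuous g.
  have f_cont : continuous f by move=> z; exact/differentiable_continuous.
  move=> z.
  exact: cvgD (f_cont z) (cvgM (cvg_cst c) (continuous_sqr_dist a z)).
have A0 : A !=set0 by exists a.
have [m _ m_min] := EVT_min_rV A0 A_compact (continuous_subspaceT g_cont).
exists (g m); split; first by exists m.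
move=> _ [z _ <-].
have [zA|zA] := pselect (A z); first by apply: m_min; rewrite inE.
apply: le_trans (m_min a _) _; first by rewrite inE.
apply: le_trans (g_lower z); rewrite lerDl mulr_ge0 ?(ltW c0)// subr_ge0.
rewrite -!sqr_norm2 lerXn2r// ?nnegrE ?sqrtr_ge0//.
rewrite leNgt; apply: contra_notN zA => lt i.
have := le_lt_trans (normr_coord_le_norm2 (z - a + q) i) lt.
rewrite !mxE ltr_norml in_itv /=; lra.
Qed.

End Gradient.

Theorem corollary1 (R : realType) (d : nat) (f : 'rV[R]_d -> R) (L eta : R)
    (theta : nat -> 'rV[R]_d)
    (f_convex : convex_function [set: convex_lmodType 'rV[R]_d] f)
    (f_diff : forall x : 'rV[R]_d, differentiable f x)
    (L_gt0 : 0 < L)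
    (f_smooth : L_smooth L f)
    (eta_range : 0 < eta <= 1 / L)
    (theta_gd : forall t : nat,
      theta t.+1 = theta t - eta *: grad f (theta t))
    (T : nat) (T_ge1 : (1 <= T)%N) (lambda : R)
    (lambdaE : lambda = 1 / (eta * T%:R)) :
  exists m1 m2 : R,
    [/\ is_min (fun z : 'rV[R]_d =>
          f z + lambda / 4 * norm2 (theta 0%N - z) ^+ 2) m1,
        is_min (fun z : 'rV[R]_d =>
          f z + lambda * norm2 (theta 0%N - z) ^+ 2) m2,
        m1 <= f (theta T) + lambda / 4 * norm2 (theta 0%N - theta T) ^+ 2 &
        f (theta T) + lambda / 4 * norm2 (theta 0%N - theta T) ^+ 2 <= m2].
Proof.
have /andP[eta0] := eta_range; rewrite ler_pdivlMr// => etaL.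
have T0 : 0 < T%:R :> R by rewrite ltr0n.
have etaT0 : 0 < eta * T%:R by exact: mulr_gt0.
have lambda0 : 0 < lambda by rewrite lambdaE divr_gt0.
have lambda40 : 0 < lambda / 4 by rewrite divr_gt0.
have [m1 m1P] := prox_is_min f f_diff (theta 0%N) (lambda / 4) f_convex lambda40.
have [m2 m2P] := prox_is_min f f_diff (theta 0%N) lambda f_convex lambda0.
exists m1, m2; split => //; first by apply: m1P.2; exists (theta T).
have [[z _ <-] _] := m2P.
have rate := gd_rate f f_diff L eta theta z T
  f_convex L_gt0 f_smooth eta0 etaL theta_gd.
have double := sqr_dist_le_double (theta 0%N) (theta T) z.
have lambdaK : eta * T%:R * lambda = 1.
  by rewrite lambdaE mul1r divff// gt_eqF.
rewrite !sqr_norm2 -(ler_pM2l etaT0) !mulrDr !mulrA lambdaK.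
lra.
Qed.
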